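(* Let $S$ be any set and let $\mathfrak I\subseteq C^\infty(\mathbb R^S)$ be an ideal. Then: (1) $\mathfrak I$ is closed in the germ topology if and only if $\mathfrak I$ is germ determined; (2) $\mathfrak I$ is closed in the jet topology if and only if $\mathfrak I$ is near-point determined; (3) $\mathfrak I$ is closed in the point topology if and only if $\mathfrak I$ is point determined.
   Context: Smooth functions on $\mathbb R^S$: for a set $S$ (possibly infinite), $\mathbb R^S$ is the space of functions $S\to\mathbb R$. A function $\mathbb R^S\to\mathbb R$ is smooth if it factors as a projection $\pi_F:\mathbb R^S\to\mathbb R^F$ onto a finite set $F\subseteq S$ of coordinates followed by a smooth function $\mathbb R^F\to\mathbb R$. $C^\infty(\mathbb R^S)$ is the ring of all smooth functions on $\mathbb R^S$ (it is the free $\mathcal C^\infty$-ring generated by $S$). Germs and jets: $f,g\in C^\infty(\mathbb R^S)$ have the same germ at $p\in\mathbb R^S$, written $f_p=g_p$, if for some finite $F\subseteq S$ both factor through $\pi_F$ and the induced functions on $\mathbb R^F$ have the same germ at $\pi_F(p)$. They have the same $k$-jet at $p$, written $J^k_p(f)=J^k_p(g)$, if for some finite $F\subseteq S$ both factor through $\pi_F$ and the induced functions on $\mathbb R^F$ have the same $k$-jet at $\pi_F(p)$. Topologies on $C^\infty(\mathbb R^S)$: below, $\{p_i\}$ ranges over finite sets of points in $\mathbb R^S$, $\{k_i\}$ over families of non-negative integers, one for each $p_i$, and $f$ over $C^\infty(\mathbb R^S)$. - The germ topology has as a basis $\emptyset$ and all sets $\{g : g_{p_i}=f_{p_i}\ \forall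 i\}$. - The jet topology has as a basis $\emptyset$ and all sets $\{g : J^{k_i}_{p_i}(g)=J^{k_i}_{p_i}(f)\ \forall i\}$. - The point topology has as a basis $\emptyset$ and all sets $\{g : g(p_i)=f(p_i)\ \forall i\}$. Types of ideals: an ideal $\mathfrak I\subseteq C^\infty(\mathbb R^S)$ is - germ determined if every $f\in C^\infty(\mathbb R^S)$ such that for all $p\in\mathbb R^S$ there is $g\in\mathfrak I$ with $f_p=g_p$ belongs to $\mathfrak I$; - near-point determined if every $f\in C^\infty(\mathbb R^S)$ such that for all $p\in\mathbb R^S$ and all $k\in\mathbb Z_{\ge 0}$ there is $g\in\mathfrak I$ with $J^k_p(f)=J^k_p(g)$ belongs to $\mathfrak I$; - point determined if every $f\in C^\infty(\mathbb R^S)$ such that for all $p\in\mathbb R^S$ there is $g\in\mathfrak I$ with $f(p)=g(p)$ belongs to $\mathfrak I$. *)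

(* Defs.v *)
From HB Require Import structures.
From mathcomp Require Import all_boot all_order all_algebra.
From mathcomp Require Import all_classical all_reals all_analysis.

Set Implicit Arguments.
Unset Strict Implicit.
Unset Printing Implicit Defensive.
Import Order.TTheory GRing.Theory Num.Theory.
Import numFieldNormedType.Exports.

Local Open Scope classical_set_scope.
Local Open Scope ring_scope.

Section PartialDerivatives.
Context {R : realType} {I : Type}.
Implicit Types (x : I -> R) (phi psi : (I -> R) -> R).

Definition update x (i : I) (t : R) : I -> R :=
  fun j => if `[< j = i >] then t else x j.

Definition slice phi x (i : I) : R -> R := fun t => phi (update x i t).

Definition partial phi (i : I) : (I -> R) -> R :=
  fun x => derive1 (slice phi x i) (x i).

(* [partials phi [:: i1; ..; ik]] differentiates along [i1] first. *)
Definition partials phi (l : seq I) : (I -> R) -> R := foldl partial phi l.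

(* [phi] is C^oo: all iterated partial derivatives exist and are continuous.
   Only meaningful, and only used, for finite [I]. *)
Definition smooth phi : Prop := forall l : seq I,
  continuous (partials phi l : {ptws I -> R} -> R) /\
  forall i x, derivable (slice (partials phi l) x i) (x i) 1.

End PartialDerivatives.

Section SmoothLemmas.
Context {R : realType} {I : Type}.
Implicit Types (x : I -> R) (phi psi : (I -> R) -> R).

Let ctsD (T : topologicalType) (f g : T -> R) :
  continuous f -> continuous g -> continuous (f + g).
Proof. by move=> cf cg x; apply: cvgD; [exact: cf|exact: cg]. Qed.

Let ctsM (T : topologicalType) (f g : T -> R) :
  continuous f -> continuous g -> continuous (f * g).
Proof. by move=> cf cg x; apply: cvgM; [exact: cf|exact: cg]. Qed.

Lemma update_id x i : update x i (x i) = x.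
Proof. by apply/funext => j; rewrite /update; case: asboolP => // ->. Qed.

Lemma slice_id phi x i : slice phi x i (x i) = phi x.
Proof. by rewrite /slice update_id. Qed.

Lemma smooth_coind (P : ((I -> R) -> R) -> Prop) :
  (forall phi, P phi ->
    [/\ continuous (phi : {ptws I -> R} -> R),
        forall i x, derivable (slice phi x i) (x i) 1
      & forall i, P (partial phi i)]) ->
  forall phi, P phi -> smooth phi.
Proof.
move=> H phi Pphi l; elim: l phi Pphi => [|i l IH] phi Pphi.
  by have [? ? _] := H _ Pphi.
by apply: (IH (partial phi i)); have [_ _] := H _ Pphi; apply.
Qed.

Lemma smooth_unfold phi : smooth phi ->
  [/\ continuous (phi : {ptws I -> R} -> R),
      forall i x, derivable (slice phi x i) (x i) 1
    & forall i, smooth (partial phi i)].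
Proof.
move=> sphi; split; [exact: (sphi [::]).1|exact: (sphi [::]).2|].
by move=> i l; exact: (sphi (i :: l)).
Qed.

Lemma partial_cst (c : R) i : partial (cst c : (I -> R) -> R) i = cst 0.
Proof.
by apply/funext => x; rewrite /partial (_ : slice _ _ _ = cst c)// derive1_cst.
Qed.

Lemma smooth_cst (c : R) : smooth (cst c : (I -> R) -> R).
Proof.
apply: (smooth_coind (P := fun phi => exists c, phi = cst c)); last by exists c.
move=> _ [d ->]; split.
- exact: (@cst_continuous {ptws I -> R} R d).
- by move=> i x; exact: derivable_cst.
- by move=> i; exists 0; exact: partial_cst.
Qed.

Inductive smooth_closure : ((I -> R) -> R) -> Prop :=
| sc_base phi of smooth phi : smooth_closure phi
| sc_add phi psi of smooth_closure phi & smooth_closure psi :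
    smooth_closure (phi + psi)
| sc_mul phi psi of smooth_closure phi & smooth_closure psi :
    smooth_closure (phi * psi).

Lemma smooth_closureP phi : smooth_closure phi -> smooth phi.
Proof.
apply: smooth_coind => {}phi; elim=> {phi}.
- move=> phi /smooth_unfold[c d s]; split => // i.
  by apply: sc_base; exact: s.
- move=> phi psi sphi [c1 d1 s1] spsi [c2 d2 s2]; split.
  + exact: (@ctsD {ptws I -> R}).
  + by move=> i x; apply: derivableD; [exact: d1|exact: d2].
  + move=> i; rewrite (_ : partial _ i = partial phi i + partial psi i).
      by apply: sc_add.
    apply/funext => x; rewrite /partial.
    rewrite (_ : slice (phi + psi) x i = slice phi x i + slice psi x i)//.
    rewrite -[RHS]/(derive1 _ _ + derive1 _ _) !derive1E.
    exact: deriveD.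
- move=> phi psi sphi [c1 d1 s1] spsi [c2 d2 s2]; split.
  + exact: (@ctsM {ptws I -> R}).
  + by move=> i x; apply: derivableM; [exact: d1|exact: d2].
  + move=> i.
    rewrite (_ : partial _ i = phi * partial psi i + psi * partial phi i).
      by apply: sc_add; apply: sc_mul.
    apply/funext => x; rewrite /partial.
    rewrite (_ : slice (phi * psi) x i = slice phi x i * slice psi x i)//.
    rewrite -[RHS]/(phi x * derive1 _ _ + psi x * derive1 _ _) !derive1E.
    by rewrite deriveM// !slice_id.
Qed.

Lemma smoothD phi psi : smooth phi -> smooth psi -> smooth (phi + psi).
Proof. by move=> *; apply: smooth_closureP; apply: sc_add; exact: sc_base. Qed.

Lemma smoothM phi psi : smooth phi -> smooth psi -> smooth (phi * psi).
Proof. by move=> *; apply: smooth_closureP; apply: sc_mul; exact: sc_base. Qed.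

Lemma smoothN phi : smooth phi -> smooth (- phi).
Proof.
move=> sphi; rewrite (_ : - phi = cst (-1) * phi).
  by apply: smoothM => //; exact: smooth_cst.
by apply/funext => x; rewrite -[LHS]/(- phi x) -[LHS]mulN1r.
Qed.

(* Equality of k-jets: all partial derivatives of order at most [k] agree. *)
Definition jet_eq (k : nat) x phi psi : Prop :=
  forall l : seq I, (size l <= k)%N -> partials phi l x = partials psi l x.

End SmoothLemmas.

Lemma coord_continuous (U : topologicalType) (J : Type) (j : J) :
  continuous ((fun x => x j) : {ptws J -> U} -> U).
Proof.
move=> x; have /cvg_sup/(_ j)/cvg_image : x --> (x : {ptws J -> U}).
  by apply: cvg_id.
move=> h; apply: cvg_trans (h _) => {h}.
  by move=> Q /= [W nbdW <-]; apply: filterS nbdW; exact: preimage_image.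
by rewrite eqEsubset; split => // y _; exists (cst y).
Qed.

Lemma continuous_ptws (T U : topologicalType) (I : Type)
    (f : T -> {ptws I -> U}) :
  (forall i, continuous (fun t => f t i)) -> continuous f.
Proof.
move=> cf x; apply/cvg_sup => i V [W [[X oX <-] Xx]] /filterS; apply.
by apply: (cf i); exact: open_nbhs_nbhs.
Qed.

Section Reindexing.
Context {R : realType} {I J : Type} (e : I -> J) (inj_e : injective e).
Implicit Types (phi psi : (I -> R) -> R).

Definition pull phi : (J -> R) -> R := fun x => phi (x \o e).

Lemma update_comp_in (x : J -> R) i t :
  update x (e i) t \o e = update (x \o e) i t.
Proof.
apply/funext => j; rewrite /update/=; case: asboolP => [/inj_e ->|ne].
  by rewrite asboolT.
by rewrite asboolF// => ji; apply: ne; rewrite ji.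
Qed.

Lemma update_comp_out (x : J -> R) j t : ~ range e j ->
  update x j t \o e = x \o e.
Proof.
move=> jNe; apply/funext => i; rewrite /update/= asboolF// => eij.
by apply: jNe; exists i.
Qed.

Lemma slice_pull_in phi x i : slice (pull phi) x (e i) = slice phi (x \o e) i.
Proof. by apply/funext => t; rewrite /slice /pull update_comp_in. Qed.

Lemma slice_pull_out phi x j : ~ range e j ->
  slice (pull phi) x j = cst (phi (x \o e)).
Proof. by move=> H; apply/funext => t; rewrite /slice /pull update_comp_out. Qed.

Lemma partial_pull_in phi i : partial (pull phi) (e i) = pull (partial phi i).
Proof. by apply/funext => x; rewrite /partial slice_pull_in. Qed.

Lemma partial_pull_out phi j : ~ range e j -> partial (pull phi) j = cst 0.
Proof.
by move=> H; apply/funext => x; rewrite /partial slice_pull_out// derive1_cst.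
Qed.

Let reindex : {ptws J -> R} -> {ptws I -> R} := fun x => (x : J -> R) \o e.

Let continuous_reindex : continuous reindex.
Proof.
apply: continuous_ptws => i; exact: coord_continuous.
Qed.

Lemma continuous_pull phi : continuous (phi : {ptws I -> R} -> R) ->
  continuous (pull phi : {ptws J -> R} -> R).
Proof.
move=> cphi x; exact: (@continuous_comp _ _ _ reindex phi x
  (@continuous_reindex x) (cphi _)).
Qed.

Lemma near_pull (P : set (I -> R)) (x : J -> R) :
  (\forall y \near (x \o e : {ptws I -> R}), P y) ->
  \forall y \near (x : {ptws J -> R}), P (y \o e).
Proof. exact: (@continuous_reindex x). Qed.

Lemma smooth_pull phi : smooth phi -> smooth (pull phi).
Proof.
move=> sphi.
apply: (smooth_coind (P := fun chi => exists2 phi, smooth phi & chi = pull phi));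
  last by exists phi.
move=> _ [{sphi}{}phi /smooth_unfold[c d s] ->]; split.
- exact: continuous_pull.
- move=> j x; have [[i _ <-]|jNe] := pselect (range e j).
    by rewrite slice_pull_in; exact: d.
  by rewrite slice_pull_out//; exact: derivable_cst.
- move=> j; have [[i _ <-]|jNe] := pselect (range e j).
    by exists (partial phi i); rewrite ?partial_pull_in//; exact: s.
  exists (cst 0); first exact: smooth_cst.
  by rewrite partial_pull_out.
Qed.

Lemma jet_eq_pull k (x : J -> R) phi psi :
  jet_eq k (x \o e) phi psi -> jet_eq k x (pull phi) (pull psi).
Proof.
move=> + l; elim: l k phi psi => [|j l IH] k phi psi jeq lk.
  exact: (jeq [::]).
case: k jeq lk => // k jeq lk.
have [[i _ <-]|jNe] := pselect (range e j); last first.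
  by rewrite /partials/= !partial_pull_out.
rewrite /partials/= !partial_pull_in; apply: (IH k) => // l' l'k.
exact: (jeq (i :: l')).
Qed.

End Reindexing.

Section SmoothFunctions.
Context {R : realType} {S : Type}.
Implicit Types (f g : (S -> R) -> R) (F : set S) (p : S -> R).

Definition projF F : (S -> R) -> (F -> R) := fun x => x \o val.

(* [phi] is determined by [f] and [F] (see [factors_inj]); its smoothness is
   automatic once [f] is smooth through some finite set of coordinates. *)
Definition factors F f (phi : (F -> R) -> R) : Prop :=
  [/\ finite_set F, smooth phi & f = phi \o @projF F].

Definition is_smooth f : Prop := exists F (phi : (F -> R) -> R), factors f phi.

Lemma factors_widen F G f (phi : (F -> R) -> R) :
  finite_set G -> F `<=` G -> factors f phi ->
  exists e : F -> G, [/\ injective e, val \o e = val & factors f (pull e phi)].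
Proof.
move=> fG FG [fF sphi fE].
have inG (i : F) : (val i : S) \in G by apply/mem_set/FG/set_valP.
pose e (i : F) : G := SigSub (inG i).
have ie : injective e by move=> i j /(congr1 val)/= /val_inj.
exists e; split => //; split => //; first exact: smooth_pull.
Qed.

Definition smooth_fun : {pred (S -> R) -> R} := [pred f | `[< is_smooth f >]].

Lemma smooth_funP f : reflect (is_smooth f) (f \in smooth_fun).
Proof. exact: asboolP. Qed.

Lemma smooth_fun_cst (c : R) : (cst c : (S -> R) -> R) \in smooth_fun.
Proof.
apply/smooth_funP; exists set0, (cst c); split => //; exact: smooth_cst.
Qed.

Lemma factors2 f g : is_smooth f -> is_smooth g ->
  exists F (phi psi : (F -> R) -> R), factors f phi /\ factors g psi.
Proof.
move=> [F [phi fphi]] [G [psi gpsi]].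
have fFG : finite_set (F `|` G).
  by rewrite finite_setU; split; [case: fphi|case: gpsi].
have [e [_ _ e1]] := factors_widen fFG (@subsetUl _ F G) fphi.
have [h [_ _ h1]] := factors_widen fFG (@subsetUr _ F G) gpsi.
by exists (F `|` G), (pull e phi), (pull h psi).
Qed.

Lemma smooth_fun_subring : subring_closed smooth_fun.
Proof.
split; first exact: smooth_fun_cst.
- move=> f g /smooth_funP sf /smooth_funP sg; apply/smooth_funP.
  have [F [phi [psi [[fF sphi ->] [_ spsi ->]]]]] := factors2 sf sg.
  exists F, (phi - psi); split; [exact: fF| |by []].
  by apply: smoothD; [exact: sphi|exact: smoothN].
- move=> f g /smooth_funP sf /smooth_funP sg; apply/smooth_funP.
  have [F [phi [psi [[fF sphi ->] [_ spsi ->]]]]] := factors2 sf sg.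
  by exists F, (phi * psi); split; [exact: fF|exact: smoothM|].
Qed.

HB.instance Definition _ :=
  GRing.isSubringClosed.Build ((S -> R) -> R) smooth_fun smooth_fun_subring.

End SmoothFunctions.

(* C^oo(R^S), a subring of the ring of all functions R^S -> R. *)
Record Cinf (R : realType) (S : Type) := MkCinf {
  Cinf_fun :> (S -> R) -> R;
  Cinf_smooth : Cinf_fun \in @smooth_fun R S }.

HB.instance Definition _ (R : realType) (S : Type) :=
  [isSub for @Cinf_fun R S].
HB.instance Definition _ (R : realType) (S : Type) :=
  [Choice of Cinf R S by <:].
HB.instance Definition _ (R : realType) (S : Type) :=
  [SubChoice_isSubComNzRing of Cinf R S by <:].

Section Ideals.
Context {R : realType} {S : Type}.
Implicit Types (f g : Cinf R S) (p : S -> R) (k : nat) (F : set S).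
Implicit Types (I : set (Cinf R S)).

(* Not necessarily proper, unlike the ideals of [ring_quotient]. *)
Definition is_ideal I : Prop :=
  [/\ I 0, forall f g, I f -> I g -> I (f + g)
    & forall a f, I f -> I (a * f)].

Definition same_germ p f g : Prop :=
  exists F (phi psi : (F -> R) -> R), [/\ factors f phi, factors g psi
    & \forall x \near (projF p : {ptws F -> R}), phi x = psi x].

Definition same_jet k p f g : Prop :=
  exists F (phi psi : (F -> R) -> R), [/\ factors f phi, factors g psi
    & jet_eq k (projF p) phi psi].

Definition germ_determined I : Prop :=
  forall f, (forall p, exists2 g, I g & same_germ p f g) -> I f.

Definition near_point_determined I : Prop :=
  forall f, (forall p k, exists2 g, I g & same_jet k p f g) -> I f.

Definition point_determined I : Prop :=
  forall f, (forall p, exists2 g, I g & f p = g p) -> I f.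

Definition germ_basis : set (set (Cinf R S)) :=
  [set U | U = set0 \/ exists (A : set (S -> R)) (f : Cinf R S), finite_set A /\
    U = [set g | forall p, A p -> same_germ p g f]].

(* Only the values of [K] on [A] matter. *)
Definition jet_basis : set (set (Cinf R S)) :=
  [set U | U = set0 \/ exists (A : set (S -> R)) (K : (S -> R) -> nat) (f : Cinf R S),
    finite_set A /\ U = [set g | forall p, A p -> same_jet (K p) p g f]].

Definition point_basis : set (set (Cinf R S)) :=
  [set U | U = set0 \/ exists (A : set (S -> R)) (f : Cinf R S), finite_set A /\
    U = [set g : Cinf R S | forall p, A p -> g p = f p]].

Lemma is_smoothP f : is_smooth f.
Proof. exact/smooth_funP/Cinf_smooth. Qed.

Lemma factors_inj (F : set S) f (phi psi : (F -> R) -> R) :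
  factors f phi -> factors f psi -> phi = psi.
Proof.
move=> [_ _ fphi] [_ _ fpsi]; apply/funext => x.
pose y (s : S) : R :=
  if pselect (s \in F) is left sF then x (SigSub sF) else 0.
have yx : projF y = x.
  apply/funext => i; rewrite /projF/= /y; case: pselect => [iF|]; last first.
    by move/negP; rewrite (valP i).
  by congr x; apply/val_inj.
rewrite -yx -[LHS]/((phi \o @projF R S F) y) -[RHS]/((psi \o @projF R S F) y).
by rewrite -fphi fpsi.
Qed.

(* A relation between functions on R^F that persists under enlarging F induces
   an equivalence relation on C^oo(R^S). *)
Section Induced.
Variable E : forall F : set S, (F -> R) -> ((F -> R) -> R) -> ((F -> R) -> R) -> Prop.
Hypothesis Erefl : forall F x phi, @E F x phi phi.
Hypothesis Esym : forall F x phi psi, @E F x phi psi -> @E F x psi phi.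
Hypothesis Etrans : forall F x phi psi chi,
  @E F x phi psi -> @E F x psi chi -> @E F x phi chi.
Hypothesis Epull : forall (F G : set S) (e : F -> G) x phi psi, injective e ->
  @E F (x \o e) phi psi -> @E G x (pull e phi) (pull e psi).

Let ind p f g := exists F (phi psi : (F -> R) -> R),
  [/\ factors f phi, factors g psi & @E F (projF p) phi psi].

Lemma induced_refl p f : ind p f f.
Proof. by have [F [phi fphi]] := is_smoothP f; exists F, phi, phi. Qed.

Lemma induced_sym p f g : ind p f g -> ind p g f.
Proof. by move=> [F [phi [psi [? ? /Esym ?]]]]; exists F, psi, phi. Qed.

Lemma induced_trans p f g h : ind p f g -> ind p g h -> ind p f h.
Proof.
move=> [F [phi [psi [fphi gpsi Ephi]]]] [G [chi [xi [gchi hxi Echi]]]].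
have fFG : finite_set (F `|` G).
  by rewrite finite_setU; split; [case: fphi|case: hxi].
have subs (F' : set S) (u v : Cinf R S) (a b : (F' -> R) -> R) :
    F' `<=` F `|` G -> factors u a -> factors v b -> E (projF p) a b ->
    exists a' b' : ((F `|` G : set S) -> R) -> R,
      [/\ factors u a', factors v b' & E (projF p) a' b'].
  move=> F'FG ua vb Eab; have [e [ie eE ue]] := factors_widen fFG F'FG ua.
  have projE x : @projF R _ _ x \o e = projF x.
    by apply/funext => i; exact: (congr1 (fun h : F' -> S => x (h i)) eE).
  exists (pull e a), (pull e b); split => //.
    case: vb => _ sb vE; split; [exact: fFG|exact: smooth_pull|].
    rewrite vE; apply/funext => x; rewrite /= /pull; congr b.
    by rewrite -projE.
  by apply: Epull => //; rewrite projE.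
have [f1 [g1 [ff1 gg1 E1]]] := subs _ _ _ _ _ (@subsetUl _ F G) fphi gpsi Ephi.
have [g2 [h2 [gg2 hh2 E2]]] := subs _ _ _ _ _ (@subsetUr _ F G) gchi hxi Echi.
exists (F `|` G), f1, h2; split => //; apply: Etrans E1 _.
by rewrite (factors_inj gg1 gg2).
Qed.

End Induced.

Let germ_rel (F : set S) (x : F -> R) (phi psi : (F -> R) -> R) :=
  \forall y \near (x : {ptws F -> R}), phi y = psi y.

Let germ_trans (F : set S) (x : F -> R) (phi psi chi : (F -> R) -> R) :
  germ_rel x phi psi -> germ_rel x psi chi -> germ_rel x phi chi.
Proof. by apply: (@filterS2 _ _ (@nbhs_filter {ptws F -> R} x)) => y -> ->. Qed.

Let germ_sym (F : set S) (x : F -> R) (phi psi : (F -> R) -> R) :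
  germ_rel x phi psi -> germ_rel x psi phi.
Proof. by apply: (@filterS _ _ (@nbhs_filter {ptws F -> R} x)) => y ->. Qed.

Let germ_pull (F G : set S) (e : F -> G) (x : G -> R) phi psi : injective e ->
  germ_rel (x \o e) phi psi -> germ_rel x (pull e phi) (pull e psi).
Proof. by move=> _; exact: (@near_pull R F G e (fun y => phi y = psi y)). Qed.

Lemma same_germ_refl p f : same_germ p f f.
Proof.
apply: (@induced_refl germ_rel) => F x phi.
by apply: (@filterE _ _ (@nbhs_filter {ptws F -> R} x)).
Qed.

Lemma same_germ_sym p f g : same_germ p f g -> same_germ p g f.
Proof. exact: (@induced_sym germ_rel germ_sym). Qed.

Lemma same_germ_trans p f g h :
  same_germ p f g -> same_germ p g h -> same_germ p f h.
Proof. exact: (@induced_trans germ_rel germ_trans germ_pull). Qed.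

Lemma same_jet_refl k p f : same_jet k p f f.
Proof. exact: (@induced_refl (fun F => @jet_eq R F k)). Qed.

Lemma same_jet_sym k p f g : same_jet k p f g -> same_jet k p g f.
Proof.
apply: (@induced_sym (fun F => @jet_eq R F k)).
by move=> F x phi psi H l lk; rewrite H.
Qed.

Lemma same_jet_trans k p f g h :
  same_jet k p f g -> same_jet k p g h -> same_jet k p f h.
Proof.
apply: (@induced_trans (fun F => @jet_eq R F k)).
- by move=> F x phi psi chi H1 H2 l lk; rewrite H1 ?H2.
- by move=> F G e x phi psi ie; exact: jet_eq_pull.
Qed.

Lemma same_jet_le k k' p f g : (k <= k')%N -> same_jet k' p f g -> same_jet k p f g.
Proof.
move=> kk' [F [phi [psi [? ? H]]]]; exists F, phi, psi; split => // l lk.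
by apply: H; exact: leq_trans kk'.
Qed.

Lemma germ_basis_cover : \bigcup_(U in germ_basis) id U = setT.
Proof.
apply/seteqP; split => // f _; exists setT => //; right.
by exists set0, f; split => //; apply/seteqP; split => // g _ p [].
Qed.

Lemma germ_basis_join U V f : germ_basis U -> germ_basis V -> U f -> V f ->
  exists W, [/\ germ_basis W, W f & W `<=` U `&` V].
Proof.
move=> [->//|[A [a [fA ->]]]] [->//|[B [b [fB ->]]]] Uf Vf.
exists [set g | forall p, (A `|` B) p -> same_germ p g f]; split.
- by right; exists (A `|` B), f; rewrite finite_setU.
- by move=> p _; exact: same_germ_refl.
- move=> g H; split => p Ap; apply: same_germ_trans (H p _) _.
  + by left.
  + exact: Uf.
  + by right.
  + exact: Vf.
Qed.

Lemma jet_basis_cover : \bigcup_(U in jet_basis) id U = setT.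
Proof.
apply/seteqP; split => // f _; exists setT => //; right.
by exists set0, (cst 0), f; split => //; apply/seteqP; split => // g _ p [].
Qed.

Lemma jet_basis_join U V f : jet_basis U -> jet_basis V -> U f -> V f ->
  exists W, [/\ jet_basis W, W f & W `<=` U `&` V].
Proof.
move=> [->//|[A [K [a [fA ->]]]]] [->//|[B [L [b [fB ->]]]]] Uf Vf.
exists [set g | forall p, (A `|` B) p -> same_jet (maxn (K p) (L p)) p g f]; split.
- by right; exists (A `|` B), (fun p => maxn (K p) (L p)), f; rewrite finite_setU.
- by move=> p _; exact: same_jet_refl.
- move=> g H; split => p Ap.
  + apply: same_jet_trans (Uf p Ap).
    by apply: same_jet_le (H p _); [exact: leq_maxl|left].
  + apply: same_jet_trans (Vf p Ap).
    by apply: same_jet_le (H p _); [exact: leq_maxr|right].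
Qed.

Lemma point_basis_cover : \bigcup_(U in point_basis) id U = setT.
Proof.
apply/seteqP; split => // f _; exists setT => //; right.
by exists set0, f; split => //; apply/seteqP; split => // g _ p [].
Qed.

Lemma point_basis_join U V f : point_basis U -> point_basis V -> U f -> V f ->
  exists W, [/\ point_basis W, W f & W `<=` U `&` V].
Proof.
move=> [->//|[A [a [fA ->]]]] [->//|[B [b [fB ->]]]] Uf Vf.
exists [set g : Cinf R S | forall p, (A `|` B) p -> g p = f p]; split.
- by right; exists (A `|` B), f; rewrite finite_setU.
- by [].
- move=> g H; split => p Ap; rewrite H; [exact: Uf|by left|exact: Vf|by right].
Qed.

End Ideals.

(* C^oo(R^S) with the germ, jet and point topology respectively. *)
Definition germ_space (R : realType) (S : Type) : Type := Cinf R S.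
HB.instance Definition _ (R : realType) (S : Type) :=
  Choice.on (germ_space R S).
HB.instance Definition _ (R : realType) (S : Type) :=
  isBaseTopological.Build (germ_space R S)
    (@germ_basis_cover R S) (@germ_basis_join R S).

Definition jet_space (R : realType) (S : Type) : Type := Cinf R S.
HB.instance Definition _ (R : realType) (S : Type) :=
  Choice.on (jet_space R S).
HB.instance Definition _ (R : realType) (S : Type) :=
  isBaseTopological.Build (jet_space R S)
    (@jet_basis_cover R S) (@jet_basis_join R S).

Definition point_space (R : realType) (S : Type) : Type := Cinf R S.
HB.instance Definition _ (R : realType) (S : Type) :=
  Choice.on (point_space R S).
HB.instance Definition _ (R : realType) (S : Type) :=
  isBaseTopological.Build (point_space R S)
    (@point_basis_cover R S) (@point_basis_join R S).

(* Main.v *)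
(** The three cases share one argument. If [f] agrees (up to germ, jet or value)
    at every point with some element of the ideal, then for finitely many points
    [p_i] with such elements [g_i] one picks smooth [e_i] whose germ is 1 at
    [p_i] and 0 at the other points: [\sum_i e_i * g_i] lies in the ideal and
    has the germ of [g_i] at each [p_i], so [f] is adherent to the ideal; the
    converse only uses the basic neighbourhoods given by a single point. Since
    distinct points differ in some coordinate, [e_i] is a product of
    one-variable smooth steps. *)
Require Import Defs.
From mathcomp Require Import all_boot all_order all_algebra.
From mathcomp Require Import all_classical all_reals all_analysis.
From mathcomp Require Import ring lra.
Import Order.TTheory GRing.Theory Num.Theory.
Import numFieldNormedType.Exports.

Local Open Scope classical_set_scope.

(** * Smooth steps on the real line *)

Section Bump.
Local Open Scope ring_scope.
Context {R : realType}.
Implicit Types (f g : R -> R) (x a c : R).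

(* The family [x^-n exp(-1/x)], extended by [0] to [x <= 0]; indexing by [n]
   makes it closed under differentiation up to linear combinations. *)
Definition flat (n : nat) (x : R) : R :=
  if 0 < x then x^-1 ^+ n * expR (- x^-1) else 0.

Lemma flat_npos n x : x <= 0 -> flat n x = 0.
Proof. by rewrite /flat ltNge => ->. Qed.

Lemma flat_ge0 n x : 0 <= flat n x.
Proof.
rewrite /flat; case: ifPn => // x0; apply: mulr_ge0; last exact: expR_ge0.
by rewrite exprn_ge0// invr_ge0 ltW.
Qed.

Lemma flat_gt0 n x : 0 < x -> 0 < flat n x.
Proof. by move=> x0; rewrite /flat x0 mulr_gt0 ?expR_gt0// exprn_gt0// invr_gt0. Qed.

(** This follows from [exp(y) >= 1 + y^(n+2) / (n+2)!] at [y = 1/x]. The order [x^2] makes the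
    difference quotient of [flat n] at 0 tend to 0. *)
Lemma flat_le n x : 0 < x -> flat n x <= n.+2`!%:R * x ^+ 2.
Proof.
move=> x0; have y0 : 0 < x^-1 by rewrite invr_gt0.
have f0 : 0 < n.+2`!%:R :> R by rewrite ltr0n fact_gt0.
have := @expR_ge1Dxn R x^-1 n.+1 (ltW y0) => h.
rewrite /flat x0 expRN ler_pdivrMr ?expR_gt0//.
apply: (@le_trans _ _ (n.+2`!%:R * x ^+ 2 * (1 + x^-1 ^+ n.+2 / n.+2`!%:R))).
  have -> : n.+2`!%:R * x ^+ 2 * (1 + x^-1 ^+ n.+2 / n.+2`!%:R) =
      n.+2`!%:R * x ^+ 2 + x^-1 ^+ n :> R.
    rewrite [x^-1 ^+ n.+2]exprS [x^-1 ^+ n.+1]exprS; field.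
    by rewrite !gt_eqF.
  by rewrite lerDr mulr_ge0 ?ltW ?exprn_gt0.
by rewrite ler_pM2l// mulr_gt0 ?exprn_gt0.
Qed.

Lemma is_derive_flat n x :
  is_derive x (1 : R) (flat n) (flat n.+2 x - n%:R * flat n.+1 x).
Proof.
have [x0|x0|->] := ltgtP x 0.
- rewrite !flat_npos ?(ltW x0)// mulr0 subr0.
  apply: (near_eq_is_derive (f := cst 0)).
  near=> y; rewrite flat_npos//; apply/ltW; near: y; exact: lt_nbhsl.
- apply: (@near_eq_is_derive R R R (fun y : R => y^-1 ^+ n * expR (- y^-1) : R)
    (flat n)).
    near=> y; rewrite /flat ifT//; near: y; exact: lt_nbhsr.
  have xN0 : x != 0 by rewrite gt_eqF.
  have dV : is_derive x (1 : R) (fun y : R => y^-1) (- x ^- 2 *: (1:R)).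
    exact: (@is_deriveV _ id).
  have dX : is_derive x (1 : R) (fun y : R => y^-1 ^+ n)
      ((n%:R * x^-1 ^+ n.-1) *: (- x ^- 2 *: (1:R))).
    by have := is_deriveX n dV; rewrite exprfctE.
  have dE : is_derive x (1 : R) (fun y : R => expR (- y^-1))
      (expR (- x^-1) * - (- x ^- 2 *: (1:R))).
    by apply: (@is_derive1_comp _ expR (fun y : R => - y^-1)).
  apply: (is_derive_eq (is_deriveM dX dE)).
  rewrite /flat x0 /GRing.scale/= !mulr1 opprK exprVn -![x ^- _]exprVn.
  (* The exponent [n.-1] of the power rule is truncated at [n = 0], where the factor [n%:R]
     vanishes; this case is computed apart. *)
  case: n {dX} => [|n]; rewrite /= !exprS; ring.
- rewrite !flat_npos// mulr0 subr0.
  suff cv : h^-1 *: ((flat n \o shift 0) (h *: (1 : R)) - flat n 0)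
      @[h --> (0 : R)^'] --> (0 : R).
    by apply: DeriveDef; [apply/cvg_ex; exists 0|exact/cvg_lim].
  rewrite flat_npos//.
  (* The difference quotient at 0 is squeezed between the two functions [(n+2)! * |h|] and its
     opposite. *)
  have cvL : n.+2`!%:R * `|h| @[h --> (0 : R)^'] --> (0 : R).
    rewrite -[X in _ --> X](mulr0 n.+2`!%:R).
    apply: cvgMr; rewrite -[X in _ --> X](@normr0 _ R).
    by apply: cvg_norm; exact: (@nbhs_dnbhs R 0).
  have cvNL : - (n.+2`!%:R * `|h|) @[h --> (0 : R)^'] --> (0 : R).
    by rewrite -[X in _ --> X]oppr0; exact: (cvgN cvL).
  apply: (squeeze_cvgr _ cvNL cvL).
  near=> h => /=; rewrite subr0 addr0 -ler_norml /GRing.scale/= mulr1.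
  have h0 : h != 0 by near: h; exact: nbhs_dnbhs_neq.
  have [hle|hgt] := leP h 0.
    by rewrite flat_npos// mulr0 normr0 mulr_ge0.
  rewrite normrM normfV ler_pdivrMl ?normr_gt0// !gtr0_norm ?flat_gt0//.
  by rewrite mulrCA -expr2 flat_le.
Unshelve. all: by end_near.
Qed.

(* A class of functions closed under differentiation, hence consisting of
   C^oo functions, and rich enough to contain smooth steps. *)
Inductive elementary : (R -> R) -> Prop :=
| el_flat n : elementary (flat n)
| el_id : elementary id
| el_cst c : elementary (cst c)
| el_add f g of elementary f & elementary g : elementary (f + g)
| el_mul f g of elementary f & elementary g : elementary (f * g)
| el_comp f g of elementary f & elementary g : elementary (f \o g)
| el_inv f of (forall x, f x != 0) & elementary f :
    elementary (fun x => (f x)^-1).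

Lemma elementary_derive f : elementary f ->
  exists2 f', elementary f' & forall x, is_derive x (1 : R) f (f' x).
Proof.
elim=> {f}.
- move=> n; exists (flat n.+2 + cst (- n%:R) * flat n.+1).
    by apply: el_add; [|apply: el_mul]; constructor.
  by move=> x; apply: is_derive_eq (is_derive_flat n x) _; rewrite -mulNr.
- by exists (cst 1); [constructor|move=> x; exact: is_derive_id].
- by move=> c; exists (cst 0); [constructor|move=> x; exact: is_derive_cst].
- move=> f g _ [f' ef' df] _ [g' eg' dg]; exists (f' + g'); first exact: el_add.
  by move=> x; exact: is_deriveD.
- move=> f g ef [f' ef' df] eg [g' eg' dg].
  exists (f * g' + g * f'); first by apply: el_add; apply: el_mul.
  by move=> x; exact: is_deriveM.
- move=> f g ef [f' ef' df] eg [g' eg' dg].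
  exists ((f' \o g) * g'); first by apply: el_mul => //; apply: el_comp.
  by move=> x; exact: is_derive1_comp.
- move=> f f0 ef [f' ef' df].
  (* This is [- f' / f^2], written as a product so that the constructors apply. *)
  exists (cst (-1) * (fun x => (f x)^-1) * (fun x => (f x)^-1) * f').
    by do ![apply: el_mul|exact: el_inv|exact: el_cst].
  move=> x; apply: is_derive_eq (is_deriveV (f0 x) (df x)) _.
  rewrite -[RHS]/(-1 * (f x)^-1 * (f x)^-1 * f' x) mulN1r mulNr -expr2 exprVn.
  by [].
Qed.

(** The step is [flat 0 u / (flat 0 u + flat 0 (1 - u))], equal to 1 where [u >= 1] and to 0 where
    [u <= 0]. The values 2 and -1 of [u] leave a margin, so both equalities hold on
    neighbourhoods. *)
Lemma exists_bump a c : a != c -> exists b, [/\ elementary b,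
  \forall t \near a, b t = 1 & \forall t \near c, b t = 0].
Proof.
move=> ac; have ac0 : a - c != 0 by rewrite subr_eq0.
have eaff (u v : R) : elementary (cst u * id + cst v).
  by apply: el_add; [apply: el_mul|]; constructor.
(* [u] is affine with [u a = 2] and [u c = -1] *)
pose u := cst (3 / (a - c)) * id + cst (- (3 * c / (a - c)) - 1) : R -> R.
pose v := cst (- 1) * u + cst 1 : R -> R.
pose d := (flat 0 \o u) + (flat 0 \o v) : R -> R.
have uE t : u t = 3 / (a - c) * t + (- (3 * c / (a - c)) - 1) by [].
have vE t : v t = 1 - u t by rewrite -[LHS]/(-1 * u t + 1) mulN1r addrC.
have dE t : d t = flat 0 (u t) + flat 0 (v t) by [].
have ua : u a = 2 by rewrite uE; field.
have uc : u c = -1 by rewrite uE; field.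
(* [u] and [1 - u] are never both nonpositive. *)
have d0 t : d t != 0.
  rewrite dE vE gt_eqF//.
  have [u0|u0] := ltP 0 (u t).
    by rewrite ltr_pwDl ?flat_gt0 ?flat_ge0.
  by rewrite ltr_wpDl ?flat_ge0 ?flat_gt0//; lra.
have cu : continuous u.
  move=> x; apply: cvgD; last exact: cvg_cst.
  by apply: cvgM; [exact: cvg_cst|exact: cvg_id].
exists ((flat 0 \o u) * (fun t => (d t)^-1)); split.
- have eu : elementary u by exact: eaff.
  have ev : elementary v.
    apply: el_add; last exact: el_cst.
    by apply: el_mul => //; exact: el_cst.
  apply: el_mul; first by apply: el_comp => //; exact: el_flat.
  by apply: el_inv => //; apply: el_add; apply: el_comp => //; exact: el_flat.
- have : \forall t \near a, 1 < u t.
    by apply: (cu a (fun y => 1 < y)); apply: lt_nbhsr; rewrite ua; lra.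
  apply: filterS => t u1.
  rewrite -[LHS]/(flat 0 (u t) / d t) dE.
  rewrite [flat 0 (v t)]flat_npos ?vE ?subr_le0 ?ltW// addr0 divff// gt_eqF//.
  by rewrite flat_gt0// (lt_trans _ u1).
- have : \forall t \near c, u t < 0.
    by apply: (cu c (fun y => y < 0)); apply: lt_nbhsl; rewrite uc; lra.
  apply: filterS => t u0.
  by rewrite -[LHS]/(flat 0 (u t) / d t) flat_npos ?mul0r// ltW.
Qed.

(** The class of functions [b (x i)] with [b] elementary is stable under partial derivatives: along
    [i] one gets [b'], along any other coordinate 0. *)
Lemma smooth_elementary_coord (I : Type) (i : I) f : elementary f ->
  smooth (fun x : I -> R => f (x i)).
Proof.
move=> ef; apply: (smooth_coind
  (P := fun phi => exists2 b, elementary b & phi = fun x : I -> R => b (x i)));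
  last first.
  by exists f.
move=> _ [b eb ->]; have [b' eb' db] := elementary_derive _ eb.
have cb : continuous b.
  by move=> x; apply/differentiable_continuous/derivable1_diffP; case: (db x).
have sliceE j (x : I -> R) : slice (fun x : I -> R => b (x i)) x j =
    if `[< i = j >] then b else cst (b (x i)).
  by apply/funext => t; rewrite /slice /update; case: asboolP.
split.
- by move=> x; apply: (cvg_comp _ _ (@Defs.coord_continuous R I i x)); exact: cb.
- move=> j x; rewrite sliceE; case: asboolP => _; last exact: derivable_cst.
  by case: (db (x i)).
- move=> j; have [ij|ij] := pselect (i = j).
    exists b' => //; apply/funext => x; rewrite /partial sliceE asboolT// ij.
    by rewrite derive1E; case: (db (x j)).
  exists (cst 0); first exact: el_cst.
  by apply/funext => x; rewrite /partial sliceE asboolF// derive1_cst.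
Qed.

End Bump.

(** * Germs on R^S and interpolation inside an ideal *)

Section Germs.
Local Open Scope ring_scope.
Context {R : realType} {S : Type}.
Implicit Types (f g : Cinf R S) (p q : S -> R).

(** This turns germs into neighbourhoods in the product topology of R^S, with no finite set of
    coordinates left to track. *)
Lemma same_germP p f g : same_germ p f g <->
  \forall x \near (p : {ptws S -> R}), f x = g x.
Proof.
split=> [[F [phi [psi [[_ _ fE] [_ _ gE] H]]]]|H].
  rewrite fE gE.
  exact: (@near_pull R F S val (fun y => phi y = psi y) p H).
have [F [phi [psi [fphi gpsi]]]] := factors2 (is_smoothP f) (is_smoothP g).
exists F, phi, psi; split => //.
(* Filling the missing coordinates with those of [p] gives a continuous section of the projection
   that sends [projF p] to [p]; neighbourhoods of [p] pull back along it. *)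
pose ext (y : F -> R) (s : S) : R :=
  if pselect (s \in F) is left sF then y (SigSub sF) else p s.
have extE y : projF (ext y) = y.
  apply/funext => i; rewrite /projF/= /ext; case: pselect => [iF|]; last first.
    by move/negP; rewrite (valP i).
  by congr y; apply/val_inj.
have extp : ext (projF p) = p.
  by apply/funext => s; rewrite /ext; case: pselect.
have cext : continuous (ext : {ptws F -> R} -> {ptws S -> R}).
  apply: continuous_ptws => s; rewrite /ext.
  case: pselect => sF; first exact: Defs.coord_continuous.
  exact: cst_continuous.
have := cext (projF p) (fun x => f x = g x); rewrite extp => /(_ H).
apply: (@filterS _ _ (@nbhs_filter {ptws F -> R} (projF p))) => y.
case: fphi gpsi => _ _ -> [_ _ ->].
by rewrite -[X in X -> _]/(phi (projF (ext y)) = psi (projF (ext y))) extE.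
Qed.

Lemma near_partials (I : Type) (x : I -> R) (phi psi : (I -> R) -> R) l :
  (\forall y \near (x : {ptws I -> R}), phi y = psi y) ->
  \forall y \near (x : {ptws I -> R}), partials phi l y = partials psi l y.
Proof.
elim: l phi psi => [//|i l IH] phi psi H; apply: IH.
(* Agreement at [y] alone would not give equal derivatives; passing to the interior gives agreement
   near [y], hence of the slices near [y i]. *)
have := @nbhs_interior {ptws I -> R} x _ H.
apply: (@filterS _ _ (@nbhs_filter {ptws I -> R} x)) => y yH.
rewrite /partial !derive1E; apply: near_eq_derive.
have cu : continuous (update y i : R -> {ptws I -> R}).
  apply: continuous_ptws => j; rewrite /update.
  case: asboolP => _; [by move=> t; exact: cvg_id|exact: cst_continuous].
have := cu (y i) (fun z => phi z = psi z); by rewrite update_id; apply; exact: yH.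
Qed.

Lemma same_germ_jet k p f g : same_germ p f g -> same_jet k p f g.
Proof.
move=> [F [phi [psi [fphi gpsi H]]]]; exists F, phi, psi; split => // l _.
exact: (@nbhs_singleton {ptws F -> R} _ _ (near_partials _ _ _ _ l H)).
Qed.

Lemma same_germ_eval p f g : same_germ p f g -> f p = g p.
Proof. by move=> /same_germP H; exact: (@nbhs_singleton {ptws S -> R} _ _ H). Qed.

Lemma separate_germs p q : p <> q ->
  exists e : Cinf R S, same_germ p e 1 /\ same_germ q e 0.
Proof.
move=> pq; have [s /eqP ps] : exists s, p s <> q s.
  by apply: contra_notP pq => /forallNP H; apply/funext => s; exact: contrapT.
have [b [eb b1 b0]] := exists_bump _ _ ps.
have sb : (fun x : S -> R => b (x s)) \in @smooth_fun R S.
  apply/smooth_funP.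
  have ss : s \in [set s] by rewrite inE.
  exists [set s], (fun y => b (y (SigSub ss))); split => //.
  exact: smooth_elementary_coord.
exists (MkCinf sb); split; apply/same_germP.
- exact: (@Defs.coord_continuous R S s p (fun t => b t = 1) b1).
- exact: (@Defs.coord_continuous R S s q (fun t => b t = 0) b0).
Qed.

(** Induction on [s]: multiplying by a function separating [p] from the new point keeps germ 1 at
    [p] and germ 0 where it was already 0. *)
Lemma isolate_germ (s : seq (S -> R)) p :
  exists e : Cinf R S, same_germ p e 1 /\
    forall q, q \in s -> q != p -> same_germ q e 0.
Proof.
elim: s => [|q s [e [e1 e0]]]; first by exists 1; split => //; exact: same_germ_refl.
have [->|qp] := eqVneq q p.
  exists e; split => // q'; rewrite inE => /orP[/eqP ->|]; last exact: e0.
  by rewrite eqxx.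
have [|e' [/same_germP e'1 /same_germP e'0]] := @separate_germs p q.
  by move=> pq; rewrite pq eqxx in qp.
have filt x := @nbhs_filter {ptws S -> R} x.
exists (e * e'); split => [|q' + q'p].
  apply/same_germP; move/same_germP: e1 => e1.
  apply: (@filterS2 _ _ (filt p) _ _ _ _ e1 e'1) => x ex e'x.
  by rewrite -[LHS]/(e x * e' x) ex e'x -[RHS]/(1 : R) mulr1.
rewrite inE => /orP[/eqP ->|q's]; apply/same_germP.
  apply: (@filterS _ _ (filt q) _ _ _ e'0) => x e'x.
  by rewrite -[LHS]/(e x * e' x) e'x mulr0.
have /same_germP e0' := e0 _ q's q'p.
apply: (@filterS _ _ (filt q') _ _ _ e0') => x ex.
by rewrite -[LHS]/(e x * e' x) ex mul0r.
Qed.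

(** The interpolant is corrected one point at a time: with [e] of germ 1 at [p] and 0 at the other
    points, [e * g p + (1 - e) * h] takes the germ of [g p] at [p] and keeps that of [h] elsewhere
    on [s]. *)
Lemma ideal_interpolate (I : set (Cinf R S)) (s : seq (S -> R))
    (g : (S -> R) -> Cinf R S) : is_ideal I -> (forall p, I (g p)) ->
  exists2 h, I h & forall p, p \in s -> same_germ p h (g p).
Proof.
move=> [I0 ID IM] Ig; elim: s => [|p s [h Ih hg]]; first by exists 0.
have [e [/same_germP e1 e0]] := isolate_germ s p.
exists (e * g p + (1 - e) * h); first by apply: ID; apply: IM.
have filt x := @nbhs_filter {ptws S -> R} x.
have val x : (e * g p + (1 - e) * h) x = e x * g p x + (1 - e x) * h x by [].
move=> q; have [->|qp] := eqVneq q p => [_|].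
  apply/same_germP; apply: (@filterS _ _ (filt p) _ _ _ e1) => x ex.
  by rewrite val ex -[(1 : Cinf R S) x]/(1 : R) subrr mul0r mul1r addr0.
rewrite inE (negbTE qp) => /= qs; apply/same_germP.
have /same_germP e0' := e0 _ qs qp; have /same_germP hg' := hg _ qs.
apply: (@filterS2 _ _ (filt q) _ _ _ _ e0' hg') => x ex hx.
by rewrite val ex hx -[(0 : Cinf R S) x]/(0 : R) subr0 mul0r mul1r add0r.
Qed.

(** The relation [r k p] stands for equality of germs, of [k]-jets or of values at [p]. Being
    implied by equality of germs, it is met by the interpolant of chosen elements [g p]. *)
Lemma adherent_determined (I : set (Cinf R S)) (B : set (set (Cinf R S)))
    (r : nat -> (S -> R) -> Cinf R S -> Cinf R S -> Prop) :
  is_ideal I ->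
  (forall k p f g, same_germ p f g -> r k p f g) ->
  (forall k p f g, r k p f g -> r k p g f) ->
  (forall k p f g h, r k p f g -> r k p g h -> r k p f h) ->
  (forall U f, B U -> U f -> exists (A : set (S -> R)) (K : (S -> R) -> nat),
    finite_set A /\ [set g | forall p, A p -> r (K p) p g f] `<=` U) ->
  (forall k p f, exists2 U, B U & U f /\ U `<=` [set g | r k p g f]) ->
  forall f, (forall U, B U -> U f -> I `&` U !=set0) <->
    (forall p k, exists2 g, I g & r k p f g).
Proof.
move=> idI rgerm rsym rtrans Bsub Bpt f; split=> [H p k|H U BU Uf].
  have [U BU [Uf Ur]] := Bpt k p f.
  by have [g [Ig /Ur/rsym gf]] := H U BU Uf; exists g.
have [A [K [/finite_seqP[s ->] AU]]] := Bsub U f BU Uf.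
have /choice[g Hg] : forall p, exists g, I g /\ r (K p) p f g.
  by move=> p; have [g Ig fg] := H p (K p); exists g.
have [h Ih hg] := ideal_interpolate _ s g idI (fun p => (Hg p).1).
exists h; split => //; apply: AU => p /= ps.
apply: rtrans (rgerm _ _ _ _ (hg p ps)) _; apply: rsym; exact: (Hg p).2.
Qed.

End Germs.

(** * Closedness tested on a base, and the three topologies *)

Lemma base_closedP (T : topologicalType) (B : set (set T)) (A : set T) :
  open = [set \bigcup_(U in D) U | D in [set D | D `<=` B]] ->
  closed A <-> forall x, (forall U, B U -> U x -> A `&` U !=set0) -> A x.
Proof.
move=> openB; split=> [cA x H|H].
  apply: cA => V; rewrite nbhsE => -[W [oW Wx] WV].
  move: oW; rewrite openB => -[D DB WE].
  move: Wx; rewrite -WE => -[U DU Ux].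
  have [y [Ay Uy]] := H U (DB _ DU) Ux.
  by exists y; split => //; apply: WV; rewrite -WE; exists U.
move=> x clx; apply: H => U BU Ux; apply: clx; apply: open_nbhs_nbhs.
split => //; rewrite openB; exists [set U]; first by move=> _ ->.
by rewrite bigcup_set1.
Qed.

Theorem proposition6 (R : realType) (S : Type) (I : set (Cinf R S))
    (idealI : is_ideal I) :
  [/\ closed (I : set (germ_space R S)) <-> germ_determined I,
      closed (I : set (jet_space R S)) <-> near_point_determined I
    & closed (I : set (point_space R S)) <-> point_determined I].
Proof.
split.
(* [erefl] suffices: in a topology built from a base, the open sets are these unions by
   definition. *)
- rewrite (@base_closedP (germ_space R S) germ_basis I erefl).
  have E := adherent_determined I germ_basis (fun=> @same_germ R S) idealI.
  have {}E f : (forall U, germ_basis U -> U f -> I `&` U !=set0) <->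
      forall p (k : nat), exists2 g, I g & same_germ p f g.
    apply: E => //.
    + by move=> _; exact: same_germ_sym.
    + by move=> _; exact: same_germ_trans.
    (* By transitivity, a basic set centred at [h] that contains [f] includes the one centred at [f]
       on the same points. *)
    + move=> _ {}f [->//|[A [h [fA ->]]]] fh.
      exists A, (fun=> 0%N); split => // g gf p Ap.
      exact: same_germ_trans (gf p Ap) (fh p Ap).
    + move=> _ p {}f; exists [set g | forall q, [set p] q -> same_germ q g f].
        by right; exists [set p], f.
      by split=> [q _|g]; [exact: same_germ_refl|exact].
  (* The relation is constant in [k], so [k] is dropped in one direction and set to 0 in the
     other. *)
  split=> H f Hf; apply: H; first by apply/E => p _; exact: Hf.
  by move=> p; exact: ((E f).1 Hf p 0%N).
- rewrite (@base_closedP (jet_space R S) jet_basis I erefl).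
  have E := adherent_determined I jet_basis (@same_jet R S) idealI.
  have {}E f : (forall U, jet_basis U -> U f -> I `&` U !=set0) <->
      forall p k, exists2 g, I g & same_jet k p f g.
    apply: E => //.
    + exact: same_germ_jet.
    + exact: same_jet_sym.
    + exact: same_jet_trans.
    + move=> _ {}f [->//|[A [K [h [fA ->]]]]] fh.
      exists A, K; split => // g gf p Ap.
      exact: same_jet_trans (gf p Ap) (fh p Ap).
    + move=> k p {}f; exists [set g | forall q, [set p] q -> same_jet k q g f].
        by right; exists [set p], (fun=> k), f.
      by split=> [q _|g]; [exact: same_jet_refl|exact].
  by split=> H f Hf; apply: H; apply/E.
- rewrite (@base_closedP (point_space R S) point_basis I erefl).
  have E := adherent_determined I point_basis
    (fun _ p (f g : Cinf R S) => f p = g p) idealI.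
  have {}E f : (forall U, point_basis U -> U f -> I `&` U !=set0) <->
      forall p (k : nat), exists2 g : Cinf R S, I g & f p = g p.
    apply: E => //.
    + by move=> _; exact: same_germ_eval.
    + by move=> _ p {}f g h -> ->.
    + move=> _ {}f [->//|[A [h [fA ->]]]] fh.
      exists A, (fun=> 0%N); split => // g gf p Ap.
      exact: etrans (gf p Ap) (fh p Ap).
    + move=> _ p {}f; exists [set g : Cinf R S | forall q, [set p] q -> g q = f q].
        by right; exists [set p], f.
      by split=> [q _|g]; [|exact].
  split=> H f Hf; apply: H; first by apply/E => p _; exact: Hf.
  by move=> p; exact: ((E f).1 Hf p 0%N).
Qed.
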